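(* Let $S$ be a monoid with unit $\mathtt{1}$ and let $(\mathcal{Q},\mathrm{N})$ be a quadratic normalisation for $S$, with $\mathcal{Q}$ finite, satisfying Condition (U) and Condition (H). Then the Thurston transducer $\mathcal{T}_{\mathcal{Q},\mathrm{N}}$ and the Mealy automaton $\mathcal{M}_{S,\mathcal{Q},\mathrm{N}}$ are dual automata, and $S$ is both an automatic monoid and an automaton monoid.
   Context: **Words.** For a set $\mathcal{Q}$, $\mathcal{Q}^+$ (resp. $\mathcal{Q}^*$) is the free semigroup (resp. free monoid) over $\mathcal{Q}$; its elements are called $\mathcal{Q}$-words, and $|w|$ is the length of $w$. **Normalisation.** A normalisation is a pair $(\mathcal{Q},\mathrm{N})$ with $\mathcal{Q}$ a set and $\mathrm{N}:\mathcal{Q}^+\to\mathcal{Q}^+$ a map such that for all $\mathcal{Q}$-words $u,v,w$: $|\mathrm{N}(w)|=|w|$; $|w|=1\Rightarrow \mathrm{N}(w)=w$; $\mathrm{N}(u\,\mathrm{N}(w)\,v)=\mathrm{N}(uwv)$ (here $u,v$ may be empty). A word $w$ is $\mathrm{N}$-normal if $\mathrm{N}(w)=w$. Let $\overline{\mathrm N}$ be the restriction of $\mathrm{N}$ to $\mathcal{Q}^2$, and for $i\ge 1$ let $\overline{\mathrm N}_i$ be the partial map on $\mathcal{Q}^+$ applying $\overline{\mathrm N}$ to the entries in positions $i,i+1$. For a finite sequence $i_1\cdots i_n$ of positive integers, $\overline{\mathrm N}_{i_1\cdots i_n}=\overline{\mathrm N}_{i_n}\circ\cdots\circ\overline{\mathrm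 N}_{i_1}$ ($\overline{\mathrm N}_{i_1}$ is applied first). **Quadratic.** $(\mathcal{Q},\mathrm{N})$ is quadratic if (i) a word is $\mathrm{N}$-normal if and only if each of its length-two factors is, and (ii) for every $\mathcal{Q}$-word $w$ there is a finite sequence $\mathbf{i}$ of positions, depending on $w$, with $\mathrm{N}(w)=\overline{\mathrm N}_{\mathbf{i}}(w)$. **Condition (H).** The breadth $(d,p)$ of a quadratic normalisation is given by $d=\max_{(q_1,q_2,q_3)\in\mathcal{Q}^3}\min\{\ell : \mathrm{N}(q_1q_2q_3)=\overline{\mathrm N}_{212\cdots}(q_1q_2q_3)\}$ and $p=\max_{(q_1,q_2,q_3)\in\mathcal{Q}^3}\min\{\ell : \mathrm{N}(q_1q_2q_3)=\overline{\mathrm N}_{121\cdots}(q_1q_2q_3)\}$, where the alternating sequences $212\cdots$ and $121\cdots$ have length $\ell\geq 0$. Condition (H) is: $p\le 3$ (and $d\le 4$). **Condition (U).** For a monoid $S$ with unit $\mathtt{1}$: $\mathtt{1}\in\mathcal{Q}$, $\mathrm{N}(\mathtt{1})=\mathtt{1}$, and $\mathrm{N}(\mathtt{1}q)=\mathrm{N}(q\mathtt{1})=\mathtt{1}q$ for each $q\in\mathcal{Q}$. **Normalisation for a monoid.** $(\mathcal{Q},\mathrm{N})$ satisfying Condition (U) is a normalisation for the monoid $S$ if $S$ is presented, as a monoid, by generators $\mathcal{Q}$ and relations $w=\mathrm{N}(w)$ for all $w\in\mathcal{Q}^+$, the letter $\mathtt{1}$ being identified with the unit of $S$ (the relation $\mathtt{1}=$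 empty word). **Mealy automata.** A Mealy automaton is a quadruple $(Q,\Sigma,\tau=(\tau_i:Q\to Q)_{i\in\Sigma},\sigma=(\sigma_x:\Sigma\to\Sigma)_{x\in Q})$ with $Q$ (stateset) and $\Sigma$ (alphabet) non-empty finite sets; it has a transition $x\xrightarrow{\,i|j\,}y$ when $\tau_i(x)=y$ and $\sigma_x(i)=j$. Its dual is the Mealy automaton $(\Sigma,Q,\sigma,\tau)$: it has the transition $i\xrightarrow{\,x|y\,}j$ exactly when the original has $x\xrightarrow{\,i|j\,}y$. Each $\sigma_x$ is extended to $\sigma_x:\Sigma^*\to\Sigma^*$ by fixing the empty word and $\sigma_x(is)=\sigma_x(i)\,\sigma_{\tau_i(x)}(s)$ for $i\in\Sigma$, $s\in\Sigma^*$. For $\mathbf{x}=x_1\cdots x_n\in Q^n$, $\sigma_{\mathbf{x}}=\sigma_{x_n}\circ\cdots\circ\sigma_{x_1}$. The semigroup generated by the automaton is the semigroup of maps $\Sigma^*\to\Sigma^*$ generated by $\{\sigma_x: x\in Q\}$, with product such that $\sigma_{\mathbf{x}}\sigma_{\mathbf{y}}=\sigma_{\mathbf{x}\mathbf{y}}$. A semigroup (monoid) is an automaton semigroup (monoid), or self-similar, if it is isomorphic to one generated by some Mealy automaton. **The two automata.** $\mathcal{M}_{S,\mathcal{Q},\mathrm{N}}$ is the Mealy automaton $(\mathcal{Q},\mathcal{Q},\tau,\sigma)$ such that $\mathrm{N}(ab)=\tau_a(b)\,\sigma_b(a)$ for all $(a,b)\in\mathcal{Q}^2$. The Thurston transducer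 $\mathcal{T}_{\mathcal{Q},\mathrm{N}}$ is the Mealy automaton with stateset $\mathcal{Q}$, alphabet $\mathcal{Q}$, and transitions $a\xrightarrow{\,b|d\,}c$ for all $a,b\in\mathcal{Q}$, where $d,c\in\mathcal{Q}$ are defined by $\mathrm{N}(ab)=dc$. **Automatic semigroups.** Let $S$ be a semigroup with finite generating set $\mathcal{Q}$ and canonical projection $\mathrm{EV}:\mathcal{Q}^+\to S$. A normal form for $(S,\mathcal{Q})$ is a map $\mathrm{NF}:S\to\mathcal{Q}^+$ with $\mathrm{EV}\circ\mathrm{NF}=\mathrm{id}_S$. It provides a right-automatic structure for $S$ if $\mathrm{NF}(S)$ is a regular language and, for each $q\in\mathcal{Q}$, the language $\{(\mathrm{NF}(a),\mathrm{NF}(aq)) : a\in S\}$ over the alphabet $(\mathcal{Q}\sqcup\{\#\})^2$ is regular, where the shorter word of each pair is right-padded with an extra symbol $\#\notin\mathcal{Q}$ so that both have equal length. $S$ is a (right-)automatic semigroup (an automatic monoid if it is a monoid) if it has such a structure. *)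

(* Defs.v *)
From HB Require Import structures.
From mathcomp Require Import all_boot.

Set Implicit Arguments.
Unset Strict Implicit.
Unset Printing Implicit Defensive.

Section Normalisation.

Variables (Q : finType) (N : seq Q -> seq Q).

(* N is defined on all of seq Q; the length axiom forces N [::] = [::], so such
   an N is the same datum as a map on non-empty words, and the instances of the
   axioms for empty words hold automatically. *)
Record normalisation : Prop := Normalisation {
  norm_size : forall w, size (N w) = size w;
  norm_letter : forall w, size w = 1 -> N w = w;
  norm_ctx : forall u w v, N (u ++ N w ++ v) = N (u ++ w ++ v)
}.

Definition normal (w : seq Q) : Prop := N w = w.

(* Positions are counted from 1; the result is None when the word has no
   entries in positions i and i.+1. *)
Definition norm_at (i : nat) (w : seq Q) : option (seq Q) :=
  if (0 < i) && (i < size w) then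
    Some (take i.-1 w ++ N (take 2 (drop i.-1 w)) ++ drop i.+1 w)
  else None.

(* The head of the sequence of positions is applied first. *)
Definition norm_seq (s : seq nat) (w : seq Q) : option (seq Q) :=
  foldl (fun ow i => obind (norm_at i) ow) (Some w) s.

Record quadratic : Prop := Quadratic {
  quad_normal : forall w, normal w <->
    (forall a b : Q, infix [:: a; b] w -> normal [:: a; b]);
  quad_seq : forall w, exists s : seq nat, norm_seq s w = Some (N w)
}.

(* alternating i j l is the sequence i j i j ... of length l. *)
Definition alternating (i j l : nat) : seq nat :=
  mkseq (fun k => if odd k then j else i) l.

Definition is_min (P : nat -> Prop) (m : nat) : Prop :=
  P m /\ forall l, P l -> m <= l.

(* l is the length of the shortest sequence i j i j ... normalising t. *)
Definition alt_length (i j : nat) (t : seq Q) (l : nat) : Prop :=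
  is_min (fun l => norm_seq (alternating i j l) t = Some (N t)) l.

Definition max_alt_length (i j m : nat) : Prop :=
  (forall q1 q2 q3 : Q,
     exists2 l, alt_length i j [:: q1; q2; q3] l & l <= m) /\
  (exists q1 q2 q3 : Q, alt_length i j [:: q1; q2; q3] m).

Definition breadth (d p : nat) : Prop :=
  max_alt_length 2 1 d /\ max_alt_length 1 2 p.

Definition condition_H : Prop :=
  exists d p, breadth d p /\ (p <= 3 /\ d <= 4).

Definition condition_U (e : Q) : Prop :=
  N [:: e] = [:: e] /\
  (forall q, N [:: e; q] = [:: e; q] /\ N [:: q; e] = [:: e; q]).

End Normalisation.

Section Presentation.

Variables (Q : Type) (R : seq Q -> seq Q -> Prop).

Inductive congruence : seq Q -> seq Q -> Prop :=
| cong_rel u w w' v : R w w' -> congruence (u ++ w ++ v) (u ++ w' ++ v)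
| cong_refl w : congruence w w
| cong_sym w w' : congruence w w' -> congruence w' w
| cong_trans w1 w2 w3 :
    congruence w1 w2 -> congruence w2 w3 -> congruence w1 w3.

Variables (S : monoidType) (ev : Q -> S).

Definition eval (w : seq Q) : S := (\big[*%g/1%g]_(q <- w) ev q)%g.

(* ev induces an isomorphism from the quotient of the free monoid seq Q by the
   congruence generated by R onto S. *)
Definition presents : Prop :=
  (forall s : S, exists w, eval w = s) /\
  (forall u v, eval u = eval v <-> congruence u v).

End Presentation.

Definition norm_relation (Q : Type) (N : seq Q -> seq Q) (e : Q)
    (w w' : seq Q) : Prop :=
  (w <> [::] /\ w' = N w) \/ (w = [:: e] /\ w' = [::]).

Definition normalisation_for (S : monoidType) (Q : finType)
    (N : seq Q -> seq Q) (e : Q) (ev : Q -> S) : Prop :=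
  [/\ normalisation N, condition_U N e & presents (norm_relation N e) ev].

(* X is the stateset, A the alphabet. *)
Record mealy (X A : finType) := Mealy {
  tau : A -> X -> X;
  sigma : X -> A -> A;
  states_gt0 : 0 < #|X|;
  letters_gt0 : 0 < #|A|
}.

Section Mealy.

Variables (X A : finType) (M : mealy X A).

(* The transition x --i|j--> y. *)
Definition transition (x : X) (i j : A) (y : X) : Prop :=
  tau M i x = y /\ sigma M x i = j.

Definition dual : mealy A X :=
  Mealy (sigma M) (tau M) (letters_gt0 M) (states_gt0 M).

Fixpoint sigma_word (x : X) (w : seq A) : seq A :=
  if w is i :: s then sigma M x i :: sigma_word (tau M i x) s else [::].

(* The head of the sequence of states acts first. *)
Definition sigma_states (xs : seq X) (w : seq A) : seq A :=
  foldl (fun v x => sigma_word x v) w xs.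

Definition generated (f : seq A -> seq A) : Prop :=
  exists2 xs : seq X, xs <> [::] & f =1 sigma_states xs.

End Mealy.

Lemma dual_transition (X A : finType) (M : mealy X A) x i j y :
  transition (dual M) i x y j <-> transition M x i j y.
Proof. by rewrite /transition /=; split; case. Qed.

(* An isomorphism phi from S onto the semigroup of maps generated by M.  The
   product of maps is composition with the left factor applied first, and the
   unit of S corresponds to the identity map. *)
Definition automaton_monoid (S : monoidType) : Prop :=
  exists (X A : finType) (M : mealy X A) (phi : S -> seq A -> seq A),
  [/\ phi 1%g =1 id,
      (forall s t, phi (s * t)%g =1 phi t \o phi s),
      (forall s t, phi s =1 phi t -> s = t),
      (forall s, generated M (phi s))
    & (forall f, generated M f -> exists s, phi s =1 f)].

Section TwoAutomata.

Variables (Q : finType) (N : seq Q -> seq Q) (e : Q).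

(* N [:: a; b] = [:: norm_fst a b; norm_snd a b]: the default value of nth is
   never used, see norm2E. *)
Definition norm_fst (a b : Q) : Q := nth e (N [:: a; b]) 0.
Definition norm_snd (a b : Q) : Q := nth e (N [:: a; b]) 1.

Lemma norm2E a b : normalisation N ->
  N [:: a; b] = [:: norm_fst a b; norm_snd a b].
Proof.
move=> NN; have := norm_size NN [:: a; b].
by rewrite /norm_fst /norm_snd; case: (N _) => [|x [|y []]].
Qed.

Lemma letters_nonempty : 0 < #|Q|.
Proof. by apply/card_gt0P; exists e. Qed.

Definition mealy_norm : mealy Q Q :=
  Mealy (fun a b => norm_fst a b) (fun b a => norm_snd a b)
    letters_nonempty letters_nonempty.

Definition thurston : mealy Q Q :=
  Mealy (fun b a => norm_snd a b) (fun a b => norm_fst a b)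
    letters_nonempty letters_nonempty.

Lemma mealy_normE a b : normalisation N ->
  N [:: a; b] = [:: tau mealy_norm a b; sigma mealy_norm b a].
Proof. exact: norm2E. Qed.

Lemma thurstonE a b c d : normalisation N ->
  transition thurston a b d c <-> N [:: a; b] = [:: d; c].
Proof.
move=> NN; rewrite (norm2E a b NN) /transition /=.
by split=> [[-> ->]|[-> ->]].
Qed.

End TwoAutomata.

Definition regular (A : finType) (L : seq A -> Prop) : Prop :=
  exists (St : finType) (init : St) (delta : St -> A -> St) (final : pred St),
  forall w, L w <-> final (foldl delta init w).

(* None is the padding letter. *)
Definition pad (A : Type) (u v : seq A) : seq (option A * option A) :=
  zip (map Some u ++ nseq (size v - size u) None)
      (map Some v ++ nseq (size u - size v) None).

Definition right_automatic_structure (S : monoidType) (A : finType)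
    (g : A -> S) (nf : S -> seq A) : Prop :=
  [/\ (forall s, nf s <> [::]),
      (forall s, eval g (nf s) = s),
      regular (fun w => exists s, w = nf s)
    & (forall q : A, regular (A := (option A * option A)%type)
         (fun w => exists s, w = pad (nf s) (nf (s * g q)%g)))].

(* A finite generating set is given by an injective map g from a finType; its
   image generates S as a semigroup because every s is the value of the
   non-empty word nf s. *)
Definition automatic_monoid (S : monoidType) : Prop :=
  exists (A : finType) (g : A -> S) (nf : S -> seq A),
    injective g /\ right_automatic_structure g nf.

(* Main.v *)
Require Import Defs.
From mathcomp Require Import all_boot.
From Stdlib Require Import Setoid IndefiniteDescription.

Set Implicit Arguments.
Unset Strict Implicit.
Unset Printing Implicit Defensive.

(** The automaton monoid.  In state [b], the automaton [mealy_norm] replaces a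
    letter [c] by the second letter of [N [:: c; b]], the first letter being the
    new state.  If its input is a word written from right to left (hence the
    reversals below), then [b] travels leftwards through this word, and one run
    computes a right multiplication by [b].  The state words [ab] and [xy] act
    in the same way whenever [N [:: a; b] = N [:: x; y]] ([sigma_word2]): on a
    letter [c], they perform the moves 1, 2 on [cab] and on [cxy], and by
    Condition (H) one more move at position 1 gives the normal form of the three
    letters, which is common to both.  Hence the output letters agree, and the
    new pairs of states have the same normal form again.  By quadraticity all
    state words with the same value in [S] act in the same way
    ([sigma_states_congruence]).
    Conversely, a normal word acts on a long power of [one] by writing itself
    there ([sigma_states_normal]), so the action determines the value.

    The automatic structure.  The normal form of an element is its normal word
    without its leading letters [one]; it exists and is unique because the
    action on powers of [one] recovers it.  Right multiplication by [q] is then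
    one run of the automaton in the state [q], and changes the length by at most
    one ([reduced_mul_size], [reduced_mul_size_le]).  The pairs (word, word
    times [q]) thus become, after putting at most one letter [one] in front of
    one component, the graph of a letter-to-letter transducer.  That transducer
    reads from right to left while padding aligns on the left: regularity is
    preserved by reversal ([regular_rev]) and by a shift of one component by one
    letter ([regular_pad_shift]). *)

(** * Closure properties of regular languages *)

Section Regular.

Variable A : finType.
Implicit Types (L : seq A -> Prop) (w : seq A).

Lemma regular_ext L1 L2 :
  (forall w, L1 w <-> L2 w) -> regular L1 -> regular L2.
Proof.
move=> E [St [i [d [f Lf]]]]; exists St, i, d, f => w.
by rewrite -E.
Qed.

Lemma regular_bool L1 L2 (L : seq A -> Prop) (op : bool -> bool -> bool) :
    (forall w (b1 b2 : bool), (L1 w <-> b1) -> (L2 w <-> b2) ->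
       (L w <-> op b1 b2)) ->
  regular L1 -> regular L2 -> regular L.
Proof.
move=> E [S1 [i1 [d1 [f1 L1f]]]] [S2 [i2 [d2 [f2 L2f]]]].
exists (S1 * S2)%type, (i1, i2), (fun s a => (d1 s.1 a, d2 s.2 a)).
exists (fun s => op (f1 s.1) (f2 s.2)) => w.
have -> : foldl (fun s a => (d1 s.1 a, d2 s.2 a)) (i1, i2) w
        = (foldl d1 i1 w, foldl d2 i2 w).
  by elim: w i1 i2 {L1f L2f} => //= a w IHw i1 i2; rewrite IHw.
exact: E.
Qed.

Lemma regular_and L1 L2 :
  regular L1 -> regular L2 -> regular (fun w => L1 w /\ L2 w).
Proof.
apply: (@regular_bool _ _ _ andb) => w b1 b2 -> ->.
by split=> [[-> ->]|/andP].
Qed.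

Lemma regular_or L1 L2 :
  regular L1 -> regular L2 -> regular (fun w => L1 w \/ L2 w).
Proof.
apply: (@regular_bool _ _ _ orb) => w b1 b2 -> ->.
by split=> [/orP|/orP].
Qed.

(** The subset construction, run on the reversed automaton: after reading [w],
    the current set contains the states from which [rev w] is accepted. *)
Lemma regular_rev L : regular L -> regular (fun w => L (rev w)).
Proof.
case=> St [i [d [f Lf]]].
pose dr (X : {set St}) a := [set s | d s a \in X].
exists {set St}, [set s | f s], dr, (fun X : {set St} => i \in X) => w.
rewrite Lf.
suff <- : forall s, (s \in foldl dr [set s | f s] w) = f (foldl d s (rev w)).
  by [].
elim/last_ind: w => [|w a IHw] s; first by rewrite inE.
by rewrite foldl_rcons inE IHw rev_rcons.
Qed.

End Regular.

Section RegularLanguages.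

Variable A : finType.
Implicit Types (L : seq A -> Prop) (w : seq A).

(** Letters sent to [None] are skipped; this gives access to one component of a
    padded word. *)
Lemma regular_pmap (B : finType) (h : B -> option A) L :
  regular L -> regular (fun w : seq B => L (pmap h w)).
Proof.
case=> St [i [d [f Lf]]].
exists St, i, (fun s b => oapp (d s) s (h b)), f => w; rewrite Lf.
by elim: w i {Lf} => //= b w IHw i; case: (h b) => [a|] /=; rewrite IHw.
Qed.

Lemma regular_map (B : finType) (h : B -> A) L :
  regular L -> regular (fun w : seq B => L (map h w)).
Proof.
move/(regular_pmap (fun b => Some (h b))); apply: regular_ext => w.
by have -> : pmap (fun b => Some (h b)) w = map h w
  by elim: w => //= b w ->.
Qed.

Lemma regular_eq (v : seq A) : regular (fun w => w = v).
Proof.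
elim: v => [|x v IHv].
  exists bool, true, (fun _ _ => false), id => w.
  case: w => [|y w]; first by split.
  by split=> // /=; elim: w => //= a w IHw /IHw.
case: IHv => St [i [d [f Lf]]].
pose dl (s : option (option St)) a :=
  match s with
  | None => None
  | Some None => if a == x then Some (Some i) else None
  | Some (Some t) => Some (Some (d t a))
  end.
exists (option (option St)), (Some None), dl.
exists (fun s => if s is Some (Some t) then f t else false).
have dlS w t : foldl dl (Some (Some t)) w = Some (Some (foldl d t w)).
  by elim: w t => //= a w IHw t; rewrite IHw.
have dlN w : foldl dl None w = None by elim: w.
case=> [|y w] //=; case: eqP => [->|ne]; last first.
  by rewrite dlN; split=> // -[].
by rewrite dlS -Lf; split=> [[]|->].
Qed.

(** The state is the last letter read, with the verdict on the part read so
    far. *)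
Lemma regular_sorted (P : pred A) (r : rel A) :
  regular (fun w => exists a v, w = a :: v /\ P a /\ path r a v).
Proof.
exists (option (A * bool)), None,
  (fun s a => if s is Some (b, ok) then Some (a, ok && r b a)
              else Some (a, P a)),
  (fun s => if s is Some (_, ok) then ok else false).
case=> [|a v] /=; first by split=> // -[? [? []]].
have -> : (exists b u, a :: v = b :: u /\ P b /\ path r b u)
          <-> P a && path r a v.
  by split=> [[b [u [[<- <-] [-> ->]]]]|/andP[]] //; exists a, v.
elim: v a (P a) => [|b v IHv] a ok /=; first by rewrite andbT.
by rewrite andbA; apply: IHv.
Qed.

End RegularLanguages.

(** * Padded pairs of words *)

Section Pad.

Variable A : finType.
Implicit Types (u v : seq A).

Local Notation letters := (option A * option A)%type.

Lemma pad_fst u v : pmap fst (pad u v) = u.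
Proof.
have -> : pmap fst (pad u v)
          = pmap id (unzip1 (pad u v)) by elim: (pad u v) => //= c p ->.
rewrite unzip1_zip; last first.
  by rewrite !size_cat !size_map !size_nseq -!maxnE maxnC.
by rewrite pmap_cat map_pK //; elim: (_ - _) => [|n] //=; rewrite cats0.
Qed.

Lemma pad_swap u v : pad v u = [seq (c.2, c.1) | c <- pad u v].
Proof.
rewrite /pad; move: (_ ++ _) (_ ++ _).
by elim=> [|x s IHs] [|y t] //=; rewrite IHs.
Qed.

Lemma pad_snd u v : pmap snd (pad u v) = v.
Proof.
rewrite -[RHS](pad_fst v u) (pad_swap u v).
by elim: (pad u v) => //= c p ->.
Qed.

(** A letter of [v] is compared with the preceding letter of [u], which is kept
    in the state; [a] stands for the letter before the first one.  The state
    [None] rejects, and [Some (None, _)] is reached on the padding letter. *)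
Lemma regular_pad_shift (a : A) (L : seq (A * A) -> Prop) : regular L ->
  regular (fun w : seq letters => exists u v,
    [/\ w = pad u v, size v = (size u).+1 & L (zip (a :: u) v)]).
Proof.
case=> St [i [d [f Lf]]].
pose dl (s : option (option A * St)) (c : letters) :=
  match s, c with
  | Some (Some x, t), (o, Some y) => Some (o, d t (x, y))
  | _, _ => None
  end.
exists (option (option A * St))%type, (Some (Some a, i)), dl.
exists (fun s => if s is Some (None, t) then f t else false) => w.
have dlN p : foldl dl None p = None by elim: p.
transitivity (exists u v, [/\ w = pad u v, size v = (size u).+1
                            & f (foldl d i (zip (a :: u) v))]).
  by split=> -[u [v [? ? /Lf ?]]]; exists u, v.
elim: w a i {L Lf} => [|[[x|] [y|]] w IHw] a i /=; rewrite ?dlN.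
- by split=> // -[[|? ?] [[|? ?] []]].
- rewrite -IHw; split=> [[[|x' u] [[|y' v] [//]]] | [u [v [-> sz Lv]]]].
    by case=> -> -> -> /= [sz] Lv; exists u, v.
  by exists (x :: u), (y :: v); rewrite /= sz.
- by split=> // -[[|? ?] [[|? ?] []]] //; case: (_ - _).
- case: w {IHw} => [|c w] /=.
    split=> [[[|x' u] [[|y' v] [//]]] | fd].
      by case=> -> /=; case: v.
    by exists [::], [:: y].
  rewrite dlN; split=> // -[[|x' u] [[|y' v] [//]]].
  by case: v.
- by split=> // -[[|? ?] [[|? ?] []]].
Qed.

Lemma regular_pad_shiftC (a : A) (L : seq (A * A) -> Prop) : regular L ->
  regular (fun w : seq letters => exists u v,
    [/\ w = pad u v, size u = (size v).+1 & L (zip u (a :: v))]).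
Proof.
move/(regular_map (fun c => (c.2, c.1)))/(regular_pad_shift a).
move/(regular_map (fun c : letters => (c.2, c.1))); apply: regular_ext => w.
have swapK (T1 T2 : Type) (s : seq T1) (t : seq T2) :
  [seq (c.2, c.1) | c <- zip s t] = zip t s.
  by elim: s t => [|x s IHs] [|y t] //=; rewrite IHs.
split=> [[u [v [E sz Lv]]]|[u [v [-> sz Lv]]]]; exists v, u.
  rewrite swapK in Lv; split=> //; rewrite pad_swap -E -map_comp.
  by rewrite -[LHS]map_id; apply: eq_map => -[].
by rewrite -pad_swap swapK.
Qed.

Lemma regular_pad_eq (L : seq (A * A) -> Prop) : regular L ->
  regular (fun w : seq letters => exists u v,
    [/\ w = pad u v, size u = size v & L (zip u v)]).
Proof.
case=> St [i [d [f Lf]]].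
pose dl (s : option St) (c : letters) :=
  match s, c with
  | Some t, (Some x, Some y) => Some (d t (x, y))
  | _, _ => None
  end.
exists (option St), (Some i), dl, (fun s => if s is Some t then f t else false).
move=> w.
have dlN p : foldl dl None p = None by elim: p.
transitivity (exists u v, [/\ w = pad u v, size u = size v
                            & f (foldl d i (zip u v))]).
  by split=> -[u [v [? ? /Lf ?]]]; exists u, v.
elim: w i {L Lf} => [|[[x|] [y|]] w IHw] i /=; rewrite ?dlN.
- split=> [[u [v [E sz]]]|fi]; last by exists [::], [::].
  by have := pad_fst u v; have := pad_snd u v; rewrite -E => <- <-.
- rewrite -IHw; split=> [[[|x' u] [[|y' v] [//]]] | [u [v [-> sz Lv]]]].
    by case=> -> -> -> /= [sz] Lv; exists u, v.
  by exists (x :: u), (y :: v); rewrite /= sz.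
- by split=> // -[[|? ?] [[|? ?] []]].
- by split=> // -[[|? ?] [[|? ?] []]].
- by split=> // -[[|? ?] [[|? ?] []]].
Qed.

(** The padding aligns [u] and [v] on the left, the transducers used here on the
    right; [a] fills the free place in front of the shorter word. *)
Lemma regular_pad (a : A) (R : seq A -> seq A -> Prop) :
  regular (fun w : seq (A * A) => R (unzip1 w) (unzip2 w)) ->
  regular (fun w : seq letters => exists u v, w = pad u v /\
    [\/ size u = size v /\ R u v,
        size v = (size u).+1 /\ R (a :: u) v
      | size u = (size v).+1 /\ R u (a :: v)]).
Proof.
move=> regR; have := regular_or (regular_pad_eq regR)
  (regular_or (regular_pad_shift a regR) (regular_pad_shiftC a regR)).
have unzipE (u v : seq A) : size u = size v ->
    unzip1 (zip u v) = u /\ unzip2 (zip u v) = v.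
  by move=> sz; rewrite unzip1_zip ?unzip2_zip ?sz.
apply: regular_ext => w; split.
  case=> [|[]] [u [v [-> sz T]]]; exists u, v; split=> //.
  - by have [E1 E2] := unzipE _ _ sz; rewrite E1 E2 in T; apply: Or31.
  - have [E1 E2] := unzipE (a :: u) v (esym sz).
    by rewrite E1 E2 in T; apply: Or32.
  - have [E1 E2] := unzipE u (a :: v) sz.
    by rewrite E1 E2 in T; apply: Or33.
case=> u [v [-> [] [sz T]]].
- by left; exists u, v; have [-> ->] := unzipE _ _ sz.
- by right; left; exists u, v; have [-> ->] := unzipE (a :: u) v (esym sz).
- by right; right; exists u, v; have [-> ->] := unzipE u (a :: v) sz.
Qed.

End Pad.

(** * Runs of a Mealy automaton *)

Section Runs.

Variables (X A : finType) (M : mealy X A).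

Definition run (x : X) (w : seq A) : X := foldl (fun y i => tau M i y) x w.

Lemma size_sigma_word x w : size (sigma_word M x w) = size w.
Proof. by elim: w x => //= i w IHw x; rewrite IHw. Qed.

Lemma sigma_word_cat x u v :
  sigma_word M x (u ++ v) = sigma_word M x u ++ sigma_word M (run x u) v.
Proof. by elim: u x => //= i u IHu x; rewrite IHu. Qed.

Lemma sigma_states_cat xs ys w :
  sigma_states M (xs ++ ys) w = sigma_states M ys (sigma_states M xs w).
Proof. exact: foldl_cat. Qed.

(** The graph of [sigma_word M x], restricted to the runs that end in [y], is
    recognised by the automaton itself, a wrong output letter being fatal. *)
Lemma regular_graph (x y : X) : regular (fun w : seq (A * A) =>
  sigma_word M x (unzip1 w) = unzip2 w /\ run x (unzip1 w) = y).
Proof.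
pose dl (s : option X) (c : A * A) :=
  if s is Some z then
    if sigma M z c.1 == c.2 then Some (tau M c.1 z) else None
  else None.
exists (option X), (Some x), dl, (fun s => s == Some y) => w.
have dlN p : foldl dl None p = None by elim: p.
elim: w x => [|[i j] w IHw] x /=.
  by split=> [[_ ->]|/eqP[->]].
case: (sigma M x i =P j) => [->|ne]; last by rewrite dlN; split=> // -[[/ne]].
by rewrite -IHw; split=> -[E1 E2]; split=> //; [case: E1 | rewrite E1].
Qed.

End Runs.

(** * Invariance of the action under normalisation *)

Section Invariance.

Variables (Q : finType) (N : seq Q -> seq Q) (one : Q).
Hypothesis NN : normalisation N.
Hypothesis quadN : quadratic N.
Hypothesis HN : condition_H N.
Hypothesis UN : condition_U N one.

Local Notation M := (mealy_norm N one).
Local Notation fst2 := (norm_fst N one).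
Local Notation snd2 := (norm_snd N one).

Lemma norm_idem w : N (N w) = N w.
Proof. by have := norm_ctx NN [::] w [::]; rewrite !cats0. Qed.

Lemma norm_oneL q : N [:: one; q] = [:: one; q].
Proof. by case: (UN.2 q). Qed.

Lemma norm_oneR q : N [:: q; one] = [:: one; q].
Proof. by case: (UN.2 q). Qed.

Lemma norm2_inj a b c d :
  N [:: a; b] = [:: c; d] -> fst2 a b = c /\ snd2 a b = d.
Proof. by rewrite (norm2E one _ _ NN) => -[]. Qed.

Lemma norm_at3 i a b c : 0 < i < 3 -> N [:: a; b; c] = [:: a; b; c] ->
  norm_at N i [:: a; b; c] = Some [:: a; b; c].
Proof.
move=> i3 /(quad_normal quadN) nrm.
have nab : N [:: a; b] = [:: a; b].
  by apply: nrm; apply/infixP; exists [::], [:: c].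
have nbc : N [:: b; c] = [:: b; c].
  by apply: nrm; apply/infixP; exists [:: a], [::].
by case: i i3 => [|[|[|i]]] //= _; rewrite /norm_at /= ?nab ?nbc.
Qed.

(** A normal word is not changed by further moves, so a shorter alternating
    sequence that normalises can be prolonged to a longer one. *)
Lemma norm_seq3 s a b c : all (fun i => 0 < i < 3) s ->
  N [:: a; b; c] = [:: a; b; c] ->
  norm_seq N s [:: a; b; c] = Some [:: a; b; c].
Proof.
move=> s3 nrm; rewrite /norm_seq; elim: s s3 => //= i s IHs /andP[i3 /IHs IH].
by rewrite norm_at3.
Qed.

Lemma norm3_121 a b c :
  norm_seq N [:: 1; 2; 1] [:: a; b; c] = Some (N [:: a; b; c]).
Proof.
case: HN => d [p [[_ [le_p _]] [p3 _]]].
have [l [El _] l_p] := le_p a b c.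
have {l_p p3} l3 : l <= 3 by apply: leq_trans p3.
have := norm_size NN [:: a; b; c]; have := norm_idem [:: a; b; c].
move: El; case: (N _) => [|x [|y [|z [|]]]] // El nrm _.
have altE : alternating 1 2 l = take l [:: 1; 2; 1].
  by case: l l3 {El} => [|[|[|[|]]]].
rewrite -(cat_take_drop l [:: 1; 2; 1]) -altE /norm_seq foldl_cat.
rewrite [foldl _ (Some [:: a; b; c]) _]El; apply: norm_seq3 => //.
by case: l {l3 El altE} => [|[|[|[|]]]].
Qed.

(** After the moves 1, 2 the third letter is final, since the last move of 121
    leaves it alone. *)
Lemma norm3E a b c :
  N [:: a; b; c] = rcons (N [:: fst2 a b; fst2 (snd2 a b) c])
                         (snd2 (snd2 a b) c).
Proof.
have := norm3_121 a b c.
rewrite /norm_seq /= /norm_at /= (norm2E one a b NN) /=.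
rewrite (norm2E one (snd2 a b) c NN) /=.
by case=> <-; rewrite (norm2E one _ _ NN).
Qed.

(** Both sides read a letter [c] as the moves 1, 2 on [c :: _], whose third
    letter is the last letter of the common normal form of [[:: c; a; b]] and
    [[:: c; x; y]]; the first two have a common normal form, so that the
    hypothesis passes to the new states. *)
Lemma sigma_word2 a b x y : N [:: a; b] = N [:: x; y] ->
  forall w,
    sigma_word M b (sigma_word M a w) = sigma_word M y (sigma_word M x w).
Proof.
move=> E w; elim: w a b x y E => //= c w IHw a b x y E.
have := norm_ctx NN [:: c] [:: x; y] [::].
rewrite -E (norm_ctx NN [:: c] [:: a; b] [::]) /= !norm3E.
by move/rcons_inj=> [/IHw -> ->].
Qed.

Lemma sigma_states_norm_at i u v w : norm_at N i u = Some v ->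
  sigma_states M u w = sigma_states M v w.
Proof.
rewrite /norm_at; case: ifP => // /andP[]; case: i => // i _ i_lt [<-].
rewrite !sigma_states_cat -{1}(cat_take_drop i u) sigma_states_cat.
rewrite [drop i u](drop_nth one) 1?ltnW // (drop_nth one) //=.
rewrite take0; set b := nth _ _ _; set a := nth _ _ _.
congr (sigma_states M _ _); rewrite (norm2E one a b NN) /=.
by apply: sigma_word2; rewrite -(norm2E one a b NN) norm_idem.
Qed.

Lemma sigma_states_norm u w : sigma_states M (N u) w = sigma_states M u w.
Proof.
have [s] := quad_seq quadN u; rewrite /norm_seq.
have foldN t : foldl (fun ow i => obind (norm_at N i) ow) None t = None.
  by elim: t.
elim: s {1 4}u => [|i s IHs] t /=; first by case=> ->.
case E: (norm_at N i t) => [t'|]; last by rewrite foldN.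
by move/IHs ->; rewrite (sigma_states_norm_at _ E).
Qed.

Lemma sigma_word_one w : sigma_word M one w = w.
Proof.
elim: w => //= c w IHw.
by have [-> ->] := norm2_inj (norm_oneR c); rewrite IHw.
Qed.

Lemma sigma_states_congruence u v : congruence (norm_relation N one) u v ->
  sigma_states M u =1 sigma_states M v.
Proof.
elim=> {u v} [u w w' v R|//|u v _ E|u v t _ Euv _ Evt] x.
- rewrite !sigma_states_cat; case: R => [[_ ->]|[-> ->]] /=.
    by rewrite sigma_states_norm.
  by rewrite sigma_word_one.
- by rewrite E.
- by rewrite Euv Evt.
Qed.

Definition normal2 : rel Q := fun a b => N [:: a; b] == [:: a; b].

Lemma normalE w : normal N w <-> sorted normal2 w.
Proof.
rewrite (quad_normal quadN); split=> [nrm|].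
  elim: w nrm => [|a [|b w] IHw] // nrm; apply/andP; split.
    by apply/eqP; apply: nrm; apply/infixP; exists [::], w.
  apply: IHw => c d /infixP[s [t E]]; apply: nrm.
  by apply/infixP; exists (a :: s), t; rewrite E.
move=> srt a b /infixP[s [t E]]; apply/eqP.
move: srt; rewrite {}E; case: s => [|c s] /=; first by case/andP.
by rewrite cat_path /= => /and4P[].
Qed.

(** Reading a normal word from right to left, each transition outputs its state
    and takes the letter as the new state, so the word is only shifted. *)
Lemma sigma_word_normal b w : path (fun x y => normal2 y x) b w ->
  sigma_word M b w = belast b w.
Proof.
elim: w b => //= c w IHw b /andP[/eqP nrm pth].
by have [-> ->] := norm2_inj nrm; rewrite IHw.
Qed.

(** The word [one], followed by any letter, is normal, so a normal word stays
    normal when letters [one] are put in front of it; each letter of [u] shifts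
    the word written so far. *)
Lemma sigma_states_normal u m : sorted normal2 u ->
  sigma_states M u (nseq (size u + m) one) = rev u ++ nseq m one.
Proof.
elim/last_ind: u m => // u b IHu m srt.
rewrite size_rcons addSnnS -cats1 sigma_states_cat IHu; last first.
  by move: srt; case: (u) => //= x v; rewrite rcons_path => /andP[].
rewrite cats1 rev_rcons -[sigma_states M [:: b] _]/(sigma_word M b _).
rewrite sigma_word_normal.
  by rewrite -[m.+1]addn1 nseqD cats1 -rcons_cat belast_rcons.
rewrite -[path _ _ _]/(sorted _ (b :: _ ++ _)) -cat_cons -rev_rcons.
rewrite -(rev_nseq m.+1) -rev_cat rev_sorted.
elim: m.+1 => [//|n IHn] /=.
by case: (_ ++ _) IHn => //= x t ->; rewrite /normal2 norm_oneL eqxx.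
Qed.

End Invariance.

(** * Normal forms and right multiplication *)

Section NormalForms.

Variables (S : monoidType) (Q : finType) (N : seq Q -> seq Q) (one : Q).
Variable ev : Q -> S.
Hypothesis NS : normalisation_for N one ev.
Hypothesis quadN : quadratic N.
Hypothesis HN : condition_H N.

Local Notation M := (mealy_norm N one).
Local Notation fst2 := (norm_fst N one).
Local Notation snd2 := (norm_snd N one).
Local Notation ones n := (nseq n one).

Let NN : normalisation N := let: And3 h _ _ := NS in h.
Let UN : condition_U N one := let: And3 _ h _ := NS in h.
Let presN : presents (norm_relation N one) ev := let: And3 _ _ h := NS in h.

Lemma eval_rel w w' : norm_relation N one w w' -> eval ev w = eval ev w'.
Proof.
move=> R; apply/presN.2.
by have := cong_rel [::] [::] R; rewrite /= !cats0.
Qed.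

Lemma eval_cat u v : eval ev (u ++ v) = (eval ev u * eval ev v)%g.
Proof. by rewrite /eval big_cat. Qed.

Lemma eval_cons a u : eval ev (a :: u) = (ev a * eval ev u)%g.
Proof. by rewrite /eval big_cons. Qed.

Lemma eval1 a : eval ev [:: a] = ev a.
Proof. by rewrite /eval big_seq1. Qed.

Lemma eval_one : ev one = 1%g.
Proof.
rewrite -eval1 (@eval_rel _ [::]); last by right.
by rewrite /eval big_nil.
Qed.

Lemma eval2 a b : (ev a * ev b)%g = (ev (fst2 a b) * ev (snd2 a b))%g.
Proof.
rewrite -!eval1 -!eval_cat /= -(norm2E one a b NN).
by apply: eval_rel; left.
Qed.

Lemma sigma_states_eval u v :
  eval ev u = eval ev v -> sigma_states M u =1 sigma_states M v.
Proof. by move/presN.2; apply: sigma_states_congruence. Qed.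

(** A run moves the factor [ev b] from the right end of the product to the left
    end, using one relation [ab = N(ab)] per letter. *)
Lemma eval_sigma b w :
  (eval ev (rev w) * ev b)%g
    = (ev (run M b w) * eval ev (rev (sigma_word M b w)))%g.
Proof.
elim: w b => [|c w IHw] b /=.
  by rewrite /eval big_nil mulg1 mul1g.
rewrite !rev_cons -!cats1 !eval_cat !eval1 -mulgA eval2.
by rewrite !mulgA IHw.
Qed.

Lemma ev_inj : injective ev.
Proof.
move=> a b E; have := @sigma_states_eval [:: a] [:: b].
rewrite !eval1 => /(_ E [:: one]) /=.
have [_ ->] := norm2_inj one NN (norm_oneL UN a).
by have [_ ->] := norm2_inj one NN (norm_oneL UN b) => -[].
Qed.

Lemma sigma_word_ones b n : sigma_word M b (ones n.+1) = b :: ones n.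
Proof.
rewrite /=; have [-> ->] := norm2_inj one NN (norm_oneL UN b).
by rewrite sigma_word_one.
Qed.

(** The unit is kept as the one-letter word so that normal forms are non-empty;
    by Condition (U) the letters [one] of a normal word form a prefix, so the
    other normal forms do not contain [one] at all. *)
Definition reduced (u : seq Q) : bool :=
  (u == [:: one]) || (head one u != one) && sorted (normal2 N) u.

Lemma reduced_sorted u : reduced u -> sorted (normal2 N) u.
Proof. by case/orP => [/eqP-> //|/andP[]]. Qed.

Lemma reduced_nil u : reduced u -> u <> [::].
Proof. by move=> + u0; rewrite u0 /reduced eqxx. Qed.

Lemma reduced_head u : reduced u -> head one u = one -> u = [:: one].
Proof. by case/orP => [/eqP //|/andP[/eqP]]. Qed.

Lemma reduced_exists s : exists u, reduced u /\ eval ev u = s.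
Proof.
have [w Ew] := presN.1 s.
have [t [t0 srt <-]] : exists t, [/\ t <> [::], sorted (normal2 N) t
                                   & eval ev t = s].
  exists (N (one :: w)); split.
  - by move=> E; have := norm_size NN (one :: w); rewrite E.
  - by apply/(normalE quadN); apply: norm_idem.
  - rewrite -(@eval_rel (one :: w)); last by left.
    by rewrite eval_cons eval_one mul1g.
elim: t t0 srt => // x t IHt _ srt.
have [x1|x1] := eqVneq x one; last first.
  by exists (x :: t); rewrite /reduced srt /= x1 orbT.
case: t IHt srt => [_ _|y t IHt srt].
  by exists [:: x]; rewrite /reduced x1 eqxx.
have [//||u [ru Eu]] := IHt; first by case/andP: srt.
by exists u; rewrite eval_cons x1 eval_one mul1g.
Qed.

Lemma reduced_ones k w v : reduced v -> ones k ++ w = v -> w <> [::] -> k = 0.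
Proof.
case: k => // k rv E w0; move: (reduced_head rv); rewrite -E /= => /(_ erefl).
by case: k {E} => //; case: w w0.
Qed.

Lemma reduced_inj u v :
  reduced u -> reduced v -> eval ev u = eval ev v -> u = v.
Proof.
wlog le_uv : u v / size u <= size v => [H|].
  case: (leqP (size u) (size v)) => [|/ltnW] le_s ru rv E; first exact: H.
  by apply/esym/H.
move=> ru rv /sigma_states_eval E.
have := E (ones (size v)); rewrite -{1}(subnKC le_uv) -{2}[size v]addn0.
rewrite !(sigma_states_normal NN UN) ?reduced_sorted // cats0.
move/(congr1 rev); rewrite rev_cat !revK rev_nseq => Ev.
have k0 := reduced_ones rv Ev (reduced_nil ru).
by rewrite k0 in Ev.
Qed.

(** The final state is the letter that a run pushes out on the left; it is
    required to be [one], so that the product has the length of [u]. *)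
Definition aligned_mul (q : Q) (u v : seq Q) : Prop :=
  sigma_word M q (rev u) = rev v /\ run M q (rev u) = one.

Lemma aligned_mul_eval q u v :
  aligned_mul q u v -> (eval ev u * ev q)%g = eval ev v.
Proof.
case=> Es Er; have := eval_sigma q (rev u).
by rewrite Er Es !revK eval_one mul1g.
Qed.

Lemma snd2_one a b : snd2 a b = one -> fst2 a b = one.
Proof.
move=> E; have := norm_idem NN [:: a; b].
by rewrite (norm2E one _ _ NN) E (norm_oneR UN) => -[].
Qed.

(** Both sides are the action of the value of [v] on a power of [one]: on the
    left through the state word [u] followed by [q], on the right through [v].
    The exponents only make the total lengths equal and leave enough room. *)
Lemma sigma_word_mul q u v :
  reduced u -> reduced v -> eval ev v = (eval ev u * ev q)%g ->
  sigma_word M q (rev u) ++ run M q (rev u) :: ones (size v)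
    = rev v ++ ones (size u).+1.
Proof.
move=> ru rv; rewrite -eval1 -eval_cat => /sigma_states_eval.
move/(_ (ones (size v + (size u).+1))).
rewrite (sigma_states_normal NN UN) ?reduced_sorted // => ->.
rewrite sigma_states_cat addnS addnC -addnS.
rewrite (sigma_states_normal NN UN) ?reduced_sorted //.
rewrite -[sigma_states M [:: q] _]/(sigma_word M q _).
by rewrite sigma_word_cat sigma_word_ones.
Qed.

(** If the length dropped by two or more, the two leftmost output letters would
    be [one]; by [snd2_one] the state in which the first letter of [u] is read
    would be [one] as well, and that letter, output unchanged, would be
    [one]. *)
Lemma reduced_mul_size q u v :
  reduced u -> reduced v -> eval ev v = (eval ev u * ev q)%g ->
  size u <= (size v).+1.
Proof.
move=> ru rv E; rewrite leqNgt; apply/negP.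
have := sigma_word_mul ru rv E; case: u ru {E} => [|x [|y u]] // ru.
rewrite !rev_cons -!cats1 -catA sigma_word_cat /= -catA /=.
set c := run _ _ _; set w := _ :: ones _ => E lt_vu.
(* Right of [rev v] there are only letters [one], and beyond the end the
   default value of [nth] is [one] as well. *)
have nth_one i : size v <= i -> nth one (rev v ++ ones (size u).+3) i = one.
  by move=> le_vi; rewrite nth_cat size_rev ltnNge le_vi nth_nseq if_same.
have := nth_one (size u).+1; have := nth_one (size u).
rewrite -E !nth_cat size_sigma_word size_rev ltnn subnn ltnNge leqnSn /=.
rewrite subSn // subnn /= => /(_ lt_vu) /snd2_one ->.
have [_ ->] := norm2_inj one NN (norm_oneR UN x).
by move=> /(_ (ltnW lt_vu)) /(reduced_head ru).
Qed.

(** A longer [v] would begin with [one], since the run copies its input once it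
    has met a letter [one]. *)
Lemma reduced_mul_size_le q u v :
  reduced u -> reduced v -> eval ev v = (eval ev u * ev q)%g ->
  size v <= (size u).+1.
Proof.
move=> ru rv E; rewrite leqNgt; apply/negP => lt_uv.
have := congr1 rev (sigma_word_mul ru rv E).
rewrite !rev_cat rev_cons revK !rev_nseq.
rewrite -(subnKC (ltnW lt_uv)) nseqD -cats1 -!catA => /eqP.
rewrite eqseq_cat ?size_nseq // => /andP[_ /eqP Ev].
have k0 : size v - (size u).+1 = 0 by apply: reduced_ones rv Ev _.
by rewrite -subn_gt0 k0 in lt_uv.
Qed.

(** The letter [one] in front of [u] absorbs the final state of the run when the
    product is longer than [u]; the one in front of [v] restores the letter
    [one] that the normal form of the product has lost. *)
Lemma reduced_mulE q u v : reduced u -> reduced v ->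
  eval ev v = (eval ev u * ev q)%g <->
  [\/ size u = size v /\ aligned_mul q u v,
      size v = (size u).+1 /\ aligned_mul q (one :: u) v
    | size u = (size v).+1 /\ aligned_mul q u (one :: v)].
Proof.
move=> ru rv; split; last first.
  by case=> -[_ /aligned_mul_eval]; rewrite ?eval_cons ?eval_one ?mul1g.
move=> E; have := sigma_word_mul ru rv E; rewrite /aligned_mul !rev_cons.
have := reduced_mul_size ru rv E; have := reduced_mul_size_le ru rv E.
have sX : size (sigma_word M q (rev u)) = size u.
  by rewrite size_sigma_word size_rev.
case: (ltngtP (size u) (size v)) => [lt_uv|lt_vu|eq_uv].
- move=> le_vu _; have {lt_uv le_vu} svu : size v = (size u).+1.
    by apply/eqP; rewrite eqn_leq le_vu.
  rewrite -cat_rcons svu => /eqP; rewrite eqseq_cat; last first.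
    by rewrite size_rcons sX size_rev.
  case/andP=> /eqP EX _; apply: Or32; split=> //.
  rewrite -cats1 sigma_word_cat /run foldl_cat /= -/(run _ _ _).
  have [-> ->] := norm2_inj one NN (norm_oneL UN (run M q (rev u))).
  by rewrite cats1.
- move=> _ le_uv; have {lt_vu le_uv} suv : size u = (size v).+1.
    by apply/eqP; rewrite eqn_leq le_uv.
  rewrite -[ones (size u).+1]/([:: one] ++ ones (size u)) catA cats1 => /eqP.
  rewrite eqseq_cat; last by rewrite size_rcons sX size_rev.
  by case/andP=> /eqP EX; rewrite suv => /eqP[Eb]; apply: Or33.
- move=> _ _ /eqP; rewrite eqseq_cat; last by rewrite sX size_rev.
  by case/andP=> /eqP EX /eqP[Eb _]; apply: Or31.
Qed.

End NormalForms.

(** * The two structures on the monoid *)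

Section Monoid.

Variables (S : monoidType) (Q : finType) (N : seq Q -> seq Q) (one : Q).
Variable ev : Q -> S.
Hypothesis NS : normalisation_for N one ev.
Hypothesis quadN : quadratic N.
Hypothesis HN : condition_H N.

Variable nf : S -> seq Q.
Hypothesis nfP : forall s, reduced N one (nf s) /\ eval ev (nf s) = s.

Local Notation M := (mealy_norm N one).

Lemma nf_eval u : reduced N one u -> nf (eval ev u) = u.
Proof.
by move=> ru; have [rn En] := nfP (eval ev u); apply: (reduced_inj NS).
Qed.

Lemma regular_reduced : regular (fun u => reduced N one u).
Proof.
have := regular_or (regular_eq [:: one])
                   (regular_sorted (fun a => a != one) (normal2 N)).
apply: regular_ext => u; rewrite /reduced; split.
  by case=> [->|[a [v [-> [a1 srt]]]]]; rewrite ?eqxx //= a1 srt orbT.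
case/orP=> [/eqP->|/andP[]]; first by left.
by case: u => [|a v] /=; [rewrite eqxx | right; exists a, v].
Qed.

Lemma regular_aligned_mul q :
  regular (fun w => aligned_mul N one q (unzip1 w) (unzip2 w)).
Proof.
have := regular_rev (regular_graph M q one).
by apply: regular_ext => w; rewrite /unzip1 /unzip2 !map_rev.
Qed.

Lemma automatic_of_nf : automatic_monoid S.
Proof.
exists Q, ev, nf; split; first exact: (ev_inj NS quadN HN).
split=> [s|s||q]; first by have [/reduced_nil] := nfP s.
- by case: (nfP s).
- apply: regular_ext regular_reduced => u; split=> [ru|[s ->]].
    by exists (eval ev u); rewrite nf_eval.
  by case: (nfP s).
have := regular_pad one (regular_aligned_mul q).
move/(regular_and (regular_pmap snd regular_reduced)).
move/(regular_and (regular_pmap fst regular_reduced)).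
apply: regular_ext => w; split=> [[ru [rv [u [v [E]]]]]|[s ->]].
  rewrite {}E pad_fst pad_snd in ru rv *.
  move/(reduced_mulE NS quadN HN q ru rv) => E.
  by exists (eval ev u); rewrite -E !nf_eval.
rewrite pad_fst pad_snd; have [ru Eu] := nfP s.
have [rv Ev] := nfP (s * ev q)%g; split=> //; split=> //.
exists (nf s), (nf (s * ev q)%g); split=> //.
by apply/(reduced_mulE NS quadN HN q ru rv); rewrite Ev Eu.
Qed.

(** Injectivity: the action of [nf s] on a long power of [one] spells out
    [nf s], whose value is [s]. *)
Lemma automaton_of_nf : automaton_monoid S.
Proof.
have phiE u v : eval ev u = eval ev v -> sigma_states M u =1 sigma_states M v.
  exact: sigma_states_eval.
have nfE s : eval ev (nf s) = s by case: (nfP s).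
exists Q, Q, M, (fun s => sigma_states M (nf s)); split.
- by move=> w; rewrite (@phiE _ [::]) // nfE /eval big_nil.
- move=> s t w; rewrite /= -sigma_states_cat; apply: phiE.
  by rewrite eval_cat !nfE.
- move=> s t E.
  have := E (nseq (size (nf s) + size (nf t)) one).
  have [NN UN _] := NS; have [rs _] := nfP s; have [rt _] := nfP t.
  move/reduced_sorted: rs => srt_s; move/reduced_sorted: rt => srt_t.
  rewrite {2}addnC !(sigma_states_normal NN UN) //.
  move/(congr1 (fun w => eval ev (rev w))).
  rewrite !rev_cat !revK !rev_nseq !eval_cat !nfE.
  have ones1 n : eval ev (nseq n one) = 1%g.
    elim: n => [|n IHn]; first by rewrite /eval big_nil.
    by rewrite eval_cons (eval_one NS) mul1g.
  by rewrite !ones1 !mul1g.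
- by move=> s; exists (nf s) => //; have [/reduced_nil] := nfP s.
- by move=> f [u _ Ef]; exists (eval ev u) => w; rewrite Ef; apply: phiE.
Qed.

End Monoid.

Theorem corollary17 (S : monoidType) (Q : finType) (N : seq Q -> seq Q)
    (one : Q) (ev : Q -> S)
    (hN : normalisation_for N one ev)
    (hquad : quadratic N)
    (hH : condition_H N) :
  thurston N one = dual (mealy_norm N one) /\
  automatic_monoid S /\ automaton_monoid S.
Proof.
split=> //.
have [nf nfP] := functional_choice _ (reduced_exists hN hquad).
by split; [apply: automatic_of_nf nfP | apply: automaton_of_nf nfP].
Qed.
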